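(* Let $(M_0,\sigma)$ be the Morse-Thue minimal system and let $L$ be the mapping torus of the action of $\sigma$ on $M_0$, with projection $p\colon L\to S^1$. Then $p\colon L\to S^1$ is a lifting space with compact and totally disconnected fibres that cannot be obtained as the inverse limit of finite covering spaces over the circle.
   Context: Lifting spaces: let $I=[0,1]$ and for a space $Y$ let $Y^I$ be the space of continuous paths in $Y$ with the compact-open topology. A continuous map $p\colon L\to X$ is a lifting space (lifting projection) if the map $L^I\to\{(\alpha,l)\in X^I\times L\mid p(l)=\alpha(0)\}$, $\beta\mapsto(p\circ\beta,\beta(0))$, is a homeomorphism; equivalently, $p$ is a Hurewicz fibration with the unique path-lifting property. The Morse-Thue system: let $A=\{0,1\}$. The Morse-Thue sequence $t=t_0t_1t_2\ldots\in A^{\{0,1,2,\ldots\}}$ is the infinite word obtained from the word $a_0=0$ by iterating $a_{n+1}=a_na_n'$ (concatenation), where $a_n'$ is obtained from $a_n$ by swapping zeroes and ones; thus $t=01101001\,10010110\ldots$. Concatenating $t$ with its reverse gives the doubly infinite sequence $\omega_0\in A^{\mathbb{Z}}$ with $\omega_0(n)=t_n$ and $\omega_0(-n-1)=t_n$ for $n\ge 0$. Let $\sigma\colon A^{\mathbb{Z}}\to A^{\mathbb{Z}}$ be the shift operator ($A^{\mathbb{Z}}$ with the product topology), and let $M_0\subset A^{\mathbb{Z}}$ be the topological closure of the orbit $\{\sigma^k(\omega_0)\mid k\in\mathbb{Z}\}$. Then $\sigma$ restricts to a self-homeomorphism of $M_0$. Mapping torus: for a self-homeomorphism $f\colon F\to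 F$ the mapping torus is the quotient $M_f=(I\times F)/\big((0,x)\sim(1,f(x))\big)$, with projection $M_f\to I/(0\sim 1)=S^1$ induced by the projection to the first component. Obtaining $p$ as an inverse limit of finite covering spaces over $S^1$ means that there is an inverse sequence of finite-sheeted covering spaces of $S^1$, with bonding maps over $S^1$, whose inverse limit with its natural projection to $S^1$ is homeomorphic over $S^1$ to $p\colon L\to S^1$. *)

(* Defs.v *)
From HB Require Import structures.
From Stdlib Require Import Relation_Operators.
From mathcomp Require Import all_boot all_order all_algebra generic_quotient.
From mathcomp Require Import boolp classical_sets functions cardinality.
From mathcomp Require Import set_interval reals topology num_topology.
From mathcomp Require Import normedtype.

Set Implicit Arguments.
Unset Strict Implicit.
Unset Printing Implicit Defensive.

Import Order.TTheory GRing.Theory Num.Theory.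
Import numFieldTopology.Exports.
Local Open Scope classical_set_scope.
Local Open Scope ring_scope.
Local Open Scope quotient_scope.

Definition homeomorphism (T U : topologicalType) (f : T -> U) : Prop :=
  continuous f /\ exists g : U -> T, [/\ continuous g, cancel f g & cancel g f].

Section GeneratedQuotient.
Variables (T : topologicalType) (r : T -> T -> Prop).

Definition generated_rel : rel T :=
  fun x y => `[< clos_refl_sym_trans T r x y >].

Lemma generated_rel_refl : reflexive generated_rel.
Proof. by move=> x; apply/asboolP; exact: rst_refl. Qed.

Lemma generated_rel_sym : symmetric generated_rel.
Proof. by move=> x y; apply: asbool_equiv_eq; split; exact: rst_sym. Qed.

Lemma generated_rel_trans : transitive generated_rel.
Proof.
move=> y x z /asboolP xy /asboolP yz.
by apply/asboolP; exact: (rst_trans _ _ _ _ _ xy yz).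
Qed.

Definition generated_equiv :=
  EquivRel _ generated_rel_refl generated_rel_sym generated_rel_trans.

Definition glued := {eq_quot generated_equiv}.

HB.instance Definition _ := Topological.copy glued (quotient_topology glued).
HB.instance Definition _ := Quotient.on glued.

End GeneratedQuotient.

Section Interval.
Variable R : realType.

Definition unit_interval := set_type (`[0, 1]%classic : set R).
HB.instance Definition _ := Topological.on unit_interval.

Lemma unit_interval0_subproof : (0 : R) \in (`[0, 1]%classic : set R).
Proof. by rewrite inE /= in_itv /= lexx ler01. Qed.

Definition unit_interval0 : unit_interval :=
  exist _ (0 : R) unit_interval0_subproof.

Definition circle :=
  glued (fun s t : unit_interval => \val s = 0 /\ \val t = 1).
HB.instance Definition _ := Topological.on circle.
HB.instance Definition _ := Quotient.on circle.

End Interval.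

Section MappingTorus.
Variables (R : realType) (F : topologicalType) (f : F -> F).

Definition mapping_torus_glue (u v : unit_interval R * F) : Prop :=
  [/\ \val u.1 = 0, \val v.1 = 1 & v.2 = f u.2].

Definition mapping_torus := glued mapping_torus_glue.
HB.instance Definition _ := Topological.on mapping_torus.
HB.instance Definition _ := Quotient.on mapping_torus.

Definition mapping_torus_proj (z : mapping_torus) : circle R :=
  \pi_(circle R) (repr z).1.

(* [mapping_torus_proj] does not depend on the representative. *)
Lemma mapping_torus_projE (u : unit_interval R * F) :
  mapping_torus_proj (\pi_mapping_torus u) = \pi_(circle R) u.1.
Proof.
rewrite /mapping_torus_proj.
have /eqmodP/asboolP : repr (\pi_mapping_torus u) = u %[mod mapping_torus].
  by rewrite reprK.
move: (repr _) => v; elim=> {u v} [u v [u0 v1 _]|//|u v _ ->//|u v w _ -> _ ->//].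
by apply/eqmodP/asboolP; apply: rst_step; split.
Qed.

End MappingTorus.

Section LiftingSpace.
Variable R : realType.

Definition path_space (Y : topologicalType) :=
  continuousType (unit_interval R) Y.

HB.instance Definition _ (Y : topologicalType) :=
  Topological.copy (path_space Y)
    (@initial_topology (continuousType (unit_interval R) Y)
       {compact-open, unit_interval R -> Y} id).

Variables (L X : topologicalType) (p : L -> X).

Definition path_pullback :=
  set_type [set z : path_space X * L | p z.2 = z.1 (unit_interval0 R)].
HB.instance Definition _ := Topological.on path_pullback.

Context (pc : continuous p).

Definition path_push (b : path_space L) : path_space X := mkcts pc \o b.

Lemma path_lift_map_subproof (b : path_space L) :
  (path_push b, b (unit_interval0 R)) \in
    [set z : path_space X * L | p z.2 = z.1 (unit_interval0 R)].
Proof. by rewrite inE. Qed.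

Definition path_lift_map (b : path_space L) : path_pullback :=
  exist _ (path_push b, b (unit_interval0 R)) (path_lift_map_subproof b).

End LiftingSpace.

Definition lifting_space (R : realType) (L X : topologicalType)
    (p : L -> X) : Prop :=
  exists pc : continuous p, homeomorphism (path_lift_map (R := R) pc).

Section Coverings.

Definition homeo_onto (E B : topologicalType) (p : E -> B)
    (V : set E) (U : set B) : Prop :=
  exists h : set_type V -> set_type U,
    homeomorphism h /\ forall e, \val (h e) = p (\val e).

Definition covering_space (E B : topologicalType) (p : E -> B) : Prop :=
  continuous p /\
  forall x : B, exists U : set B, [/\ open U, U x &
    exists S : set (set E),
      [/\ trivIset S id,
          \bigcup_(V in S) V = p @^-1` U &
          forall V, S V -> open V /\ homeo_onto p V U]].

Definition finite_covering_space (E B : topologicalType) (p : E -> B) : Prop :=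
  covering_space p /\ forall x : B, finite_set (p @^-1` [set x]).

Definition inverse_limit (E : nat -> topologicalType)
    (b : forall n, E n.+1 -> E n) :=
  set_type [set x : prod_topology E | forall n, b n (x n.+1) = x n].
HB.instance Definition _ (E : nat -> topologicalType)
    (b : forall n, E n.+1 -> E n) :=
  Topological.on (inverse_limit b).

(* When the bonding maps are over [B], all the composites [q n \o proj n]
   agree, so the projection of the limit to [B] may be read at level 0. *)
Definition inverse_limit_of_finite_coverings (L B : topologicalType)
    (p : L -> B) : Prop :=
  exists (E : nat -> topologicalType) (q : forall n, E n -> B)
         (b : forall n, E n.+1 -> E n),
    [/\ forall n, finite_covering_space (q n),
        forall n, continuous (b n),
        forall n e, q n (b n e) = q n.+1 e &
        exists h : L -> inverse_limit b,
          homeomorphism h /\ forall z, q 0%N (\val (h z) 0%N) = p z].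

End Coverings.

Fixpoint morse_thue_word (n : nat) : seq bool :=
  if n is m.+1 then morse_thue_word m ++ map negb (morse_thue_word m)
  else [:: false].

Definition morse_thue (n : nat) : bool := nth false (morse_thue_word n) n.

Lemma size_morse_thue_word n : size (morse_thue_word n) = (2 ^ n)%N.
Proof. by elim: n => //= n IH; rewrite size_cat size_map IH addnn expnS mul2n. Qed.

(* Every word is a prefix of the sequence, so the length of the word used in
   [morse_thue] is immaterial. *)
Lemma nth_morse_thue_word k n :
  (n < 2 ^ k)%N -> nth false (morse_thue_word k) n = morse_thue n.
Proof.
have step j i : (n < 2 ^ j)%N ->
    nth false (morse_thue_word (i + j)) n = nth false (morse_thue_word j) n.
  move=> nj; elim: i => //= i <-; rewrite nth_cat size_morse_thue_word.
  by rewrite (leq_trans nj)// leq_pexp2l// leq_addl.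
move=> nk; rewrite /morse_thue -(step k n nk) addnC step//.
exact: ltn_expl.
Qed.

(* A^Z with the product topology, for the alphabet {0, 1} = {false, true} *)
Definition biseq := {ptws int -> bool}.
HB.instance Definition _ := Topological.on biseq.

(* [Negz n] is [- n - 1]. *)
Definition omega0 : biseq :=
  fun k => match k with Posz n => morse_thue n | Negz n => morse_thue n end.

Definition shift (x : biseq) : biseq := fun k => x (k + 1).
Definition unshift (x : biseq) : biseq := fun k => x (k - 1).

Lemma shiftK : cancel shift unshift.
Proof. by move=> x; apply/funext => k; rewrite /unshift /shift subrK. Qed.

Lemma unshiftK : cancel unshift shift.
Proof. by move=> x; apply/funext => k; rewrite /unshift /shift addrK. Qed.

Definition shift_pow (k : int) (x : biseq) : biseq :=
  match k with
  | Posz n => iter n shift x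
  | Negz n => iter n.+1 unshift x
  end.

Lemma shift_powE k x : shift_pow k x = fun n => x (n + k).
Proof.
have P m : iter m shift x = fun n => x (n + m%:Z).
  elim: m => [|m /= ->]; apply/funext => n /=; first by rewrite addr0.
  by rewrite /shift -addrA -PoszD add1n.
have N m : iter m unshift x = fun n => x (n - m%:Z).
  elim: m => [|m /= ->]; apply/funext => n /=; first by rewrite subr0.
  by rewrite /unshift -addrA -opprD -PoszD add1n.
by case: k => m; rewrite /shift_pow ?P// N NegzE.
Qed.

Definition morse_set : set biseq :=
  closure [set shift_pow k omega0 | k in [set: int]].

Lemma biseq_reindex_continuous (s : int -> int) :
  continuous ((fun x k => x (s k)) : biseq -> biseq).
Proof.
move=> x; apply/(@cvg_sup _ _ (fun i : int => Topological.class
  (initial_topology (fun y : int -> bool => y i)))) => i A [_ [[W oW <-] Wx] WA].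
have nW := @proj_continuous int (fun=> bool) (s i) x W
  (open_nbhs_nbhs (conj oW Wx)).
by apply: (@filterS biseq (nbhs (x : biseq)) _ _ _ _ nW) => y; exact: WA.
Qed.

Lemma shift_continuous : continuous shift.
Proof. exact: biseq_reindex_continuous. Qed.

Lemma unshift_continuous : continuous unshift.
Proof. exact: (@biseq_reindex_continuous (fun k => k - 1)). Qed.

Lemma morse_set_invariant (g : biseq -> biseq) (c : int) :
  continuous g -> (forall x, g x = shift_pow c x) ->
  forall x, morse_set x -> morse_set (g x).
Proof.
move=> gc gE x Mx A /gc /Mx [_ [[k _ <-] Ak]].
exists (g (shift_pow k omega0)); split=> //; exists (c + k) => //.
by rewrite gE !shift_powE; apply/funext => n; rewrite addrA.
Qed.

Lemma morse_set_shift (x : morse_set) : shift (\val x) \in morse_set.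
Proof.
apply/mem_set; apply: (@morse_set_invariant _ 1 shift_continuous) => //.
exact: set_valP.
Qed.

Lemma morse_set_unshift (x : morse_set) : unshift (\val x) \in morse_set.
Proof.
apply/mem_set; apply: (@morse_set_invariant _ (- 1) unshift_continuous) => //.
exact: set_valP.
Qed.

Definition morse_space := set_type morse_set.
HB.instance Definition _ := Topological.on morse_space.

Definition morse_shift (x : morse_space) : morse_space :=
  exist _ (shift (\val x)) (morse_set_shift x).

Definition morse_unshift (x : morse_space) : morse_space :=
  exist _ (unshift (\val x)) (morse_set_unshift x).

Lemma morse_shift_homeomorphism : homeomorphism morse_shift.
Proof.
have C (g : biseq -> biseq) (h : morse_space -> morse_space) :
    continuous g -> (forall x, \val (h x) = g (\val x)) -> continuous h.
  move=> /continuousP gc hE; apply/continuousP => _ [W oW <-].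
  exists (g @^-1` W); first exact: gc.
  by apply/seteqP; split=> x /=; rewrite !set_valE /= hE.
split; first exact: (C _ _ shift_continuous).
exists morse_unshift; split; first exact: (C _ _ unshift_continuous).
- by move=> x; apply: val_inj; exact: shiftK.
- by move=> x; apply: val_inj; exact: unshiftK.
Qed.

(* Main.v *)
From HB Require Import structures.
From Stdlib Require Import Relation_Operators.
Require Import Defs.
From mathcomp Require Import all_boot all_order all_algebra generic_quotient.
From mathcomp Require Import boolp classical_sets functions cardinality.
From mathcomp Require Import set_interval reals interval_inference topology.
From mathcomp Require Import num_topology normedtype.
From mathcomp Require Import ring lra.

Set Implicit Arguments.
Unset Strict Implicit.
Unset Printing Implicit Defensive.

(** Let the homeomorphism f of F generate an action of the integers, and let p
    be the projection of its mapping torus L to the circle. The torus is the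
    quotient of R x F by the action n.(r, x) = (r + n, f^n x), and the circle
    is R / Z: the maps [suspension] and [expo] are continuous open surjections
    whose fibres are the orbits, and p (suspension (r, x)) = expo r. Hence
    neighbourhoods in L and in the circle can be computed upstairs
    ([nbhs_suspension], [nbhs_expo]), and translation of the first coordinate
    gives a flow on L that covers the rotations of the circle. For fixed r,
    x |-> suspension (r, x) embeds F as a fibre of p, which makes the fibres
    compact and totally disconnected when F is.

    Lifting of paths. A path a in the circle turns, up to time t, by a real
    angle: cut [0, t] into equal pieces, so short that a moves by less than
    half a turn on each, and add up the signed angles ([lift_angle]). Flowing
    a point l over a(0) along that angle gives a lift of a starting at l.
    There is no other one: flowing a lift b backwards along the same angle
    gives a path inside one totally disconnected fibre, that is, a constant
    ([lift_eq_flow]). The number of pieces can be kept constant for all paths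
    near a given one, so the explicit formula is jointly continuous in the
    path, the starting point and the time; by currying the lift depends
    continuously on (a, l) in the compact-open topology.

    No inverse limit. Suppose that L is the limit of finite coverings E_n. Each
    E_n gives a map c_n from F, seen as the fibre of L over the base point, to
    the finite fibre of E_n. By uniqueness of lifts in E_n, c_n (x) determines
    c_n (f^k x) for all k. The c_n separate points, so by compactness of F a
    given clopen set A is a union of level sets of a single c_n, and the
    pigeonhole principle shows that every forward orbit visits A at a periodic
    set of times ([inverse_limit_periodic]). Applied to the orbit of omega0 and
    to the set where the coordinate 0 equals 1, this would make the Morse-Thue
    sequence t periodic, whereas t(2n) = t(n) and t(2n + 1) = 1 - t(n) exclude
    every period: an even period could be halved, and a period 2j + 1 would
    give t(n + j) = 1 - t(n) for all n, absurd for n = j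
    ([morse_thue_aperiodic]). *)

Import Order.TTheory GRing.Theory Num.Theory.
Import numFieldTopology.Exports numFieldNormedType.Exports.
Local Open Scope classical_set_scope.
Local Open Scope ring_scope.
Local Open Scope quotient_scope.

(** * Products, subtypes and the unit interval *)

Lemma continuous_pair (T U V : topologicalType) (f : T -> U) (g : T -> V) (x : T) :
  {for x, continuous f} -> {for x, continuous g} ->
  {for x, continuous (fun t => (f t, g t))}.
Proof.
move=> fx gx A [[B C] /= [/fx fB /gx gC] BCA].
apply: (@filterS2 _ (nbhs x) _ _ _ _ _ fB gC) => t ft gt; exact: (BCA (f t, g t)).
Qed.

Lemma continuous_pairr (T U : topologicalType) (x : T) :
  continuous (fun t : U => (x, t)).
Proof. by move=> t; apply: continuous_pair; [exact: cvg_cst|exact: cvg_id]. Qed.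

(** A filter on the subtype is pushed to T, where it clusters in A. *)
Lemma set_type_compact (T : topologicalType) (A : set T) :
  compact A -> compact [set: set_type A].
Proof.
move=> cA G PG _.
have GA : (\val @ G) A by apply: (@filterE _ G) => x; exact: set_valP.
have [a [Aa cla]] := cA (\val @ G) _ GA.
exists (SigSub (mem_set Aa)); split=> // B C GB [_ [[W oW <-] /= Wa] WC].
have valB : (\val @ G) (\val @` B) by apply: (@filterS _ G _ _ _ _ GB) => b Bb; exists b.
have [_ [[b Bb <-] Wb]] := cla _ _ valB (open_nbhs_nbhs (conj oW Wa)).
by exists b; split=> //; exact: WC.
Qed.

Section Clamp.
Variable R : realType.

Lemma clamp_subproof (r : R) :
  Num.max 0 (Num.min r 1) \in (`[0, 1]%classic : set R).
Proof. by rewrite inE /= in_itv /= le_max lexx ge_max ge_min lexx ler01 orbT. Qed.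

(** Nearest-point retraction of the line onto the unit interval; it turns
    statements about the subtype into statements about real numbers. *)
Definition clamp (r : R) : unit_interval R :=
  exist _ (Num.max 0 (Num.min r 1)) (clamp_subproof r).

Lemma clampE (r : R) : 0 <= r <= 1 -> \val (clamp r) = r.
Proof. by case/andP=> r0 r1; rewrite /= (min_idPl r1) (max_idPr r0). Qed.

Lemma unit_interval_itv (s : unit_interval R) : 0 <= \val s <= 1.
Proof. by have := set_valP s; rewrite /= in_itv. Qed.

Lemma clampK (s : unit_interval R) : clamp (\val s) = s.
Proof. by apply: val_inj; rewrite clampE ?unit_interval_itv. Qed.

Lemma clamp_continuous : continuous clamp.
Proof.
apply: (@continuous_comp_initial _ _ _ set_val) => r.
by apply: (@continuous_max R R (cst 0) (fun r => Num.min r 1) r);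
  [exact: cvg_cst|apply: (@continuous_min R R id (cst 1) r); [exact: cvg_id|exact: cvg_cst]].
Qed.

Lemma unit_interval_val_continuous :
  continuous (\val : unit_interval R -> R).
Proof. exact: initial_continuous. Qed.

End Clamp.

(** * The mapping torus as a quotient of the line times the fibre *)

(** Naming the powers of f by integers avoids iterating f and its inverse
    separately. *)
Definition int_action (F : topologicalType) (f : F -> F) (act : int -> F -> F) :=
  [/\ forall x, act 0 x = x,
      forall m n x, act (m + n) x = act m (act n x),
      forall x, act 1 x = f x &
      forall n, continuous (act n)].

Section Suspension.
Variables (R : realType) (F : topologicalType) (f : F -> F).
Variable act : int -> F -> F.
Hypothesis actP : int_action f act.

Let act0 x : act 0 x = x. Proof. by case: actP. Qed.
Let actD m n x : act (m + n) x = act m (act n x). Proof. by case: actP. Qed.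
Let act1 x : act 1 x = f x. Proof. by case: actP. Qed.
Let act_continuous n : continuous (act n). Proof. by case: actP. Qed.

Let actNK n : cancel (act n) (act (- n)).
Proof. by move=> x; rewrite -actD addNr act0. Qed.

Let L := @mapping_torus R F f.

(** The gluing [0, x] ~ [1, f x] identifies (r, x) with (r + n, f^n x), hence
    the negative power. *)
Definition suspension (u : R * F) : L :=
  \pi_L (clamp (u.1 - (Num.floor u.1)%:~R), act (- Num.floor u.1) u.2).

(** The relation in the conclusion is an equivalence that contains the gluing,
    hence it contains the equivalence generated by it. *)
Lemma mapping_torus_pi_eq (u v : unit_interval R * F) :
  \pi_L u = \pi_L v ->
  exists n : int, \val v.1 = \val u.1 + n%:~R /\ v.2 = act n u.2.
Proof.
move=> /eqmodP/asboolP; elim=> {u v}.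
- by move=> u v [u0 v1 e]; exists 1; rewrite u0 v1 add0r act1.
- by move=> u; exists 0; rewrite addr0 act0.
- move=> u v _ [n [e1 e2]]; exists (- n); rewrite e1 e2 actNK.
  by rewrite intrN addrK.
- move=> u v w _ [m [e1 e2]] _ [n [e3 e4]]; exists (n + m).
  by rewrite e3 e4 e1 e2 actD intrD addrAC addrA.
Qed.

Lemma suspensionE (r : R) (x : F) :
  0 <= r <= 1 -> suspension (r, x) = \pi_L (clamp r, x).
Proof.
move=> /andP[r0 r1]; have [rlt1|rge1] := ltP r 1.
  rewrite /suspension /=.
  have -> : Num.floor r = 0 by apply: floor_def; rewrite r0 add0r.
  by rewrite subr0 oppr0 act0.
have -> : r = 1 by apply/eqP; rewrite eq_le r1.
rewrite /suspension /= floor1 subrr; apply/eqmodP/asboolP/rst_step.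
by split; rewrite ?clampE ?lexx ?ler01//= -act1 -actD subrr act0.
Qed.

Lemma suspension_surj (z : L) :
  exists2 u : R * F, 0 <= u.1 <= 1 & z = suspension u.
Proof.
rewrite -[z]reprK; case: (repr z) => s x.
exists (\val s, x); first exact: unit_interval_itv.
by rewrite suspensionE ?unit_interval_itv// clampK.
Qed.

Lemma suspensionD (n : int) (r : R) (x : F) :
  suspension (r + n%:~R, act n x) = suspension (r, x).
Proof.
rewrite /suspension /= floorDrz ?num_real// ?intr_int// intrKfloor.
by rewrite intrD opprD addrACA subrr addr0 -actD opprD addrNK.
Qed.

Lemma suspension_eq (u v : R * F) : suspension u = suspension v <->
  exists n : int, v.1 = u.1 + n%:~R /\ v.2 = act n u.2.
Proof.
case: u v => r x [r' x']; split => [/mapping_torus_pi_eq[n] /=|[n [/= -> ->]]];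
  last by rewrite suspensionD.
have fl (t : R) : 0 <= t - (Num.floor t)%:~R <= 1.
  have /andP[h1 h2] := floor_itv t.
  by rewrite subr_ge0 h1 lerBlDl (le_trans (ltW h2))// intrD.
rewrite !(min_idPl _) ?(max_idPr _); try by case/andP: (fl r); case/andP: (fl r').
move=> [e1 e2]; exists (Num.floor r' + n - Num.floor r); split.
  by rewrite !intrD intrN; lra.
rewrite -addrA !actD -e2 -actD.
by rewrite subrr act0.
Qed.

End Suspension.

Section SuspensionTopology.
Variables (R : realType) (F : topologicalType) (f : F -> F).
Variable act : int -> F -> F.
Hypothesis actP : int_action f act.

Let act_continuous n : continuous (act n). Proof. by case: actP. Qed.

Let L := @mapping_torus R F f.
Let susp : R * F -> L := suspension f act.

(** On each closed strip n <= r <= n + 1 the map agrees with one that is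
    visibly continuous ([cell n]), and two consecutive ones agree on the common
    line r = n + 1 thanks to the gluing. So near a point it is enough to look at
    the strip on the right and, when r is an integer, at the one on the left. *)
Lemma suspension_continuous : continuous susp.
Proof.
pose cell (n : int) (u : R * F) : L := \pi_L (clamp (u.1 - n%:~R), act (- n) u.2).
have cellC n : continuous (cell n).
  move=> u; apply: (@continuous_comp _ _ _ (fun u : R * F =>
    (clamp (u.1 - n%:~R), act (- n) u.2)) (\pi_L)); last exact: pi_continuous.
  apply: continuous_pair.
    apply: (@continuous_comp _ _ _ (fun u : R * F => u.1 - n%:~R)).
      by apply: cvgB; [exact: cvg_fst|exact: cvg_cst].
    exact: clamp_continuous.
  apply: (@continuous_comp _ _ _ snd (act (- n))); first exact: cvg_snd.
  exact: act_continuous.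
have cellE (n : int) u : n%:~R <= u.1 <= n%:~R + 1 -> cell n u = susp u.
  case: u => r x /= /andP[nr rn].
  rewrite /susp -(suspensionD actP (- n)) (suspensionE actP) ?intrN//.
  by rewrite subr_ge0 nr lerBlDl.
move=> u O Ou; set n := Num.floor u.1.
have /andP[n1 n2] := floor_itv u.1.
have fstC : {for u, continuous (fst : R * F -> R)} by exact: cvg_fst.
have up : \forall v \near u, n%:~R <= v.1 -> O (susp v).
  have : \forall v \near u, v.1 < n%:~R + 1.
    by apply: (fstC [set t | t < n%:~R + 1]); apply: lt_nbhsl; rewrite -[X in _ + X]/1%:~R -intrD.
  have : \forall v \near u, O (cell n v).
    by apply: (cellC n u O); rewrite cellE// n1 -[X in _ + X]/1%:~R -intrD ltW.
  by apply: filterS2 => v Ov v1 nv; rewrite -(cellE n)// nv ltW.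
have down : \forall v \near u, v.1 < n%:~R -> O (susp v).
  have [un|nu] := eqVneq u.1 n%:~R; last first.
    have : \forall v \near u, n%:~R < v.1.
      apply: (fstC [set t | n%:~R < t]); apply: lt_nbhsr.
      by rewrite lt_neqAle eq_sym nu.
    by apply: filterS => v nv vn; move: (lt_trans nv vn); rewrite ltxx.
  have n1E : (n - 1)%:~R = n%:~R - 1 :> R by rewrite intrB.
  have : \forall v \near u, n%:~R - 1 < v.1.
    apply: (fstC [set t | n%:~R - 1 < t]); apply: lt_nbhsr.
    by rewrite un ltrBlDr ltrDl.
  have : \forall v \near u, O (cell (n - 1) v).
    by apply: (cellC (n - 1) u O); rewrite cellE// n1E un subrK lexx andbT lerBlDr lerDl.
  apply: filterS2 => v Ov v1 nv; rewrite -(cellE (n - 1))// n1E subrK.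
  by rewrite !ltW.
by apply: filterS2 up down => v h1 h2; case: (leP n%:~R v.1).
Qed.

(** The saturation of O is the union of its translates by the action, whose
    traces on the unit interval times F are open. *)
Lemma suspension_open (O : set (R * F)) : open O -> open (susp @` O).
Proof.
move=> oO; suff : open (\pi_L @^-1` (susp @` O)) by [].
pose sh (n : int) (u : unit_interval R * F) : R * F := (\val u.1 + n%:~R, act n u.2).
have -> : \pi_L @^-1` (susp @` O) = \bigcup_n (sh n @^-1` O).
  have piE (s : unit_interval R) x : susp (\val s, x) = \pi_L (s, x).
    by rewrite /susp (suspensionE actP) ?unit_interval_itv// clampK.
  apply/seteqP; split => [[s x] /= [u Ou]|[s x] [n _ On]].
    by rewrite -piE => /esym/(suspension_eq actP)[n [/= e1 e2]]; exists n => //;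
       rewrite /sh /= -e1 -e2; case: (u) Ou.
  by exists (sh n (s, x)) => //; rewrite -piE; exact: (suspensionD actP).
apply: bigcup_open => n _; move: O oO; apply/continuousP => u.
apply: (@continuous_pair _ R F (fun u : unit_interval R * F => \val u.1 + n%:~R)
  (fun u => act n u.2)).
  apply: cvgD; last exact: cvg_cst.
  apply: (@continuous_comp _ _ _ fst (\val : unit_interval R -> R)); first exact: cvg_fst.
  exact: unit_interval_val_continuous.
apply: (@continuous_comp _ _ _ snd (act n)); first exact: cvg_snd.
exact: act_continuous.
Qed.

(** Because the map is continuous and open; this replaces every appeal to the
    quotient topology from here on, including for products, where a product of
    quotient maps need not be a quotient map. *)
Lemma nbhs_suspension (u : R * F) (A : set L) :
  nbhs (susp u) A <-> nbhs u (susp @^-1` A).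
Proof.
split; first exact: suspension_continuous.
rewrite (nbhsE u) => -[O [oO Ou] OA].
apply: (@filterS _ _ _ (susp @` O)); first by move=> _ [v /OA ? <-].
by apply: open_nbhs_nbhs; split; [exact: suspension_open|exists u].
Qed.

Lemma mapping_torus_proj_continuous : continuous (@mapping_torus_proj R F f).
Proof.
apply/(@quotient_continuous _ L).
have -> : @mapping_torus_proj R F f \o \pi_L = \pi_(circle R) \o fst.
  by apply/funext => u; exact: mapping_torus_projE.
move=> u; apply: continuous_comp; first exact: cvg_fst.
exact: (@pi_continuous _ (circle R)).
Qed.

End SuspensionTopology.

(** * The circle and the suspension flow *)

Section Circle.
Variable R : realType.
Local Notation circle := (circle R).

Definition expo (r : R) : circle := \pi_circle (clamp (r - (Num.floor r)%:~R)).

Lemma mapping_torus_proj_suspension (F : topologicalType) (f : F -> F)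
    (act : int -> F -> F) (u : R * F) :
  mapping_torus_proj (suspension f act u) = expo u.1.
Proof. exact: mapping_torus_projE. Qed.

Let trivial_action : @int_action R id (fun _ x => x).
Proof. by split=> // _ x; exact: cvg_id. Qed.

(** [expo] is the projection of a torus restricted to a line, so the strip
    argument for [suspension] need not be repeated. *)
Lemma expo_continuous : continuous expo.
Proof.
pose line (r : R) := suspension id (fun (_ : int) (x : R) => x) (r, 0).
have expoE r : expo r = mapping_torus_proj (line r).
  by rewrite mapping_torus_proj_suspension.
have lineC : continuous line.
  move=> r A /(suspension_continuous trivial_action) nA.
  have pairC : {for r, continuous (fun r : R => (r, 0 : R))}.
    by apply: continuous_pair; [exact: cvg_id|exact: cvg_cst].
  exact: (pairC _ nA).
move=> r A; rewrite /= expoE => /mapping_torus_proj_continuous/lineC.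
by apply: (@filterS _ (nbhs r)) => t; rewrite /= -expoE.
Qed.

Lemma expoE (s : unit_interval R) : expo (\val s) = \pi_circle s.
Proof.
have := @mapping_torus_projE R R id (s, 0) => <-.
rewrite -{2}[s]clampK -(suspensionE trivial_action) ?unit_interval_itv//.
by rewrite mapping_torus_proj_suspension.
Qed.

Lemma expo_surj (c : circle) : exists r : R, c = expo r.
Proof. by exists (\val (repr c)); rewrite expoE reprK. Qed.

Lemma expoD (n : int) (r : R) : expo (r + n%:~R) = expo r.
Proof.
by rewrite /expo floorDrz ?num_real ?intr_int// intrKfloor intrD opprD addrACA subrr addr0.
Qed.

Lemma expo_eq (r r' : R) : expo r = expo r' <-> exists n : int, r' = r + n%:~R.
Proof.
split=> [|[n ->]]; last by rewrite expoD.
have pi_eq (s t : unit_interval R) : \pi_circle s = \pi_circle t ->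
    exists n : int, \val t = \val s + n%:~R.
  move=> /eqmodP/asboolP; elim=> {s t}.
  - by move=> s t [-> ->]; exists 1; rewrite add0r.
  - by move=> s; exists 0; rewrite addr0.
  - by move=> s t _ [n ->]; exists (- n); rewrite intrN addrK.
  - by move=> s t v _ [m e1] _ [n ->]; exists (m + n); rewrite e1 intrD addrA.
have fl (t : R) : 0 <= t - (Num.floor t)%:~R <= 1.
  have /andP[h1 h2] := floor_itv t.
  by rewrite subr_ge0 h1 lerBlDl (le_trans (ltW h2))// intrD.
move=> /pi_eq[n]; rewrite !clampE// => e.
exists (Num.floor r' + n - Num.floor r).
rewrite -[LHS](subrK (Num.floor r')%:~R) e !intrD intrN; ring.
Qed.

(** Same argument as for [suspension_open]. *)
Lemma expo_open (O : set R) : open O -> open (expo @` O).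
Proof.
move=> oO; suff : open (\pi_circle @^-1` (expo @` O)) by [].
pose sh (n : int) (s : unit_interval R) : R := \val s + n%:~R.
have -> : \pi_circle @^-1` (expo @` O) = \bigcup_n (sh n @^-1` O).
  apply/seteqP; split => [s [r Or]|s [n _ On]].
    by rewrite -expoE => /esym/expo_eq[n e]; exists n; rewrite // /sh /= -e.
  by exists (sh n s) => //; rewrite expoD expoE.
have shC n : continuous (sh n).
  have addC : continuous (fun t : R => t + n%:~R).
    by move=> t; apply: cvgD; [exact: cvg_id|exact: cvg_cst].
  by move=> s A /addC/(@unit_interval_val_continuous R s).
by apply: bigcup_open => n _; move/continuousP: (shC n); exact.
Qed.

Lemma nbhs_expo (r : R) (A : set circle) :
  nbhs (expo r) A <-> nbhs r (expo @^-1` A).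
Proof.
split; first exact: expo_continuous.
rewrite (nbhsE r) => -[O [oO Or] OA].
apply: (@filterS _ _ _ (expo @` O)); first by move=> _ [v /OA ? <-].
by apply: open_nbhs_nbhs; split; [exact: expo_open|exists r].
Qed.

Definition rotate (e : R) (c : circle) : circle := expo (\val (repr c) + e).

Lemma rotate_expo (e r : R) : rotate e (expo r) = expo (r + e).
Proof.
rewrite /rotate; have : expo (\val (repr (expo r))) = expo r by rewrite expoE reprK.
by move=> /esym/expo_eq[n ->]; rewrite addrAC expoD.
Qed.

Lemma rotateD (e e' : R) (c : circle) : rotate (e + e') c = rotate e' (rotate e c).
Proof. by have [r ->] := expo_surj c; rewrite !rotate_expo addrA. Qed.

Lemma rotate0 (c : circle) : rotate 0 c = c.
Proof. by have [r ->] := expo_surj c; rewrite !rotate_expo addr0. Qed.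

(** The representative of t modulo 1 in [-1/2, 1/2[. *)
Definition centered (t : R) : R := t - (Num.floor (t + 2^-1))%:~R.

Lemma centeredDz (n : int) (t : R) : centered (t + n%:~R) = centered t.
Proof.
rewrite /centered [t + _ + 2^-1]addrAC floorDrz ?num_real ?intr_int// intrKfloor intrD.
by rewrite opprD addrACA subrr addr0.
Qed.

Lemma centered_id (t : R) : - 2^-1 <= t < 2^-1 -> centered t = t.
Proof.
move=> h; rewrite /centered (_ : Num.floor _ = 0) ?subr0//.
by apply: floor_def; rewrite add0r; lra.
Qed.

(** The signed angle from c to c', in turns; it jumps exactly when c and c' are
    antipodal. *)
Definition angle (c c' : circle) : R := centered (\val (repr c') - \val (repr c)).

Lemma angle_expo (r r' : R) : angle (expo r) (expo r') = centered (r' - r).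
Proof.
have [n e] : exists n : int, \val (repr (expo r)) = r + n%:~R.
  by apply/expo_eq; rewrite expoE reprK.
have [m e'] : exists n : int, \val (repr (expo r')) = r' + n%:~R.
  by apply/expo_eq; rewrite expoE reprK.
by rewrite /angle e e' opprD addrACA -intrN -intrD centeredDz.
Qed.

Lemma rotate_angle (c c' : circle) : rotate (angle c c') c = c'.
Proof.
have [[r ->] [r' ->]] := (expo_surj c, expo_surj c').
rewrite angle_expo rotate_expo /centered addrA -intrN expoD.
by rewrite addrCA subrr addr0.
Qed.

(** Near lifts r, r' of the two points, the integer subtracted by [centered]
    is constant, because the angle stays away from 1/2 and -1/2. *)
Lemma angle_continuous (c c' : circle) : `|angle c c'| < 2^-1 ->
  {for (c, c'), continuous (fun u => angle u.1 u.2)}.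
Proof.
have [[r ->] [r' ->]] := (expo_surj c, expo_surj c').
rewrite angle_expo => lt2; set k := Num.floor (r' - r + 2^-1).
have nearE : \forall u \near (r, r'), centered (u.2 - u.1) = u.2 - u.1 - k%:~R.
  have diffC : {for (r, r'), continuous (fun u : R * R => u.2 - u.1 - k%:~R)}.
    apply: cvgB; last exact: cvg_cst.
    by apply: cvgB; [exact: cvg_snd|exact: cvg_fst].
  have : \forall t \near centered (r' - r), `|t| < 2^-1.
    by apply: (@norm_continuous _ R^o (centered (r' - r)) [set t | t < 2^-1]); exact: lt_nbhsl.
  move=> /diffC; apply: (@filterS _ (nbhs (r, r'))) => u /= hu.
  rewrite -[LHS](centeredDz (- k)) intrN centered_id//.
  by move: hu; rewrite ltr_norml => /andP[/ltW -> ->].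
move=> A nA.
have : nbhs (r, r') ((fun u => angle (expo u.1) (expo u.2)) @^-1` A).
  have : \forall u \near (r, r'), A (u.2 - u.1 - k%:~R).
    have : {for (r, r'), continuous (fun u : R * R => u.2 - u.1 - k%:~R)}.
      apply: cvgB; last exact: cvg_cst.
      by apply: cvgB; [exact: cvg_snd|exact: cvg_fst].
    by apply; move: nA; rewrite /= angle_expo.
  by apply: filterS2 nearE => u /= e1 Au; rewrite angle_expo e1.
move=> [[B C] /= [nB nC] BCA].
exists (expo @` B, expo @` C).
  split=> /=; apply/nbhs_expo.
    by apply: filterS nB => t Bt; exists t.
  by apply: filterS nC => t Bt; exists t.
by move=> [_ _] /= [[t Bt <-] [t' Ct' <-]]; exact: (BCA (t, t')).
Qed.

End Circle.

Section Flow.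
Variables (R : realType) (F : topologicalType) (f : F -> F).
Variable act : int -> F -> F.
Hypothesis actP : int_action f act.

Let L := @mapping_torus R F f.
Let susp : R * F -> L := suspension f act.

Definition suspension_flow (e : R) (z : L) : L :=
  susp (\val (repr z).1 + e, (repr z).2).

Lemma suspension_flowE (e r : R) (x : F) :
  suspension_flow e (susp (r, x)) = susp (r + e, x).
Proof.
rewrite /suspension_flow; have : susp (\val (repr (susp (r, x))).1, (repr (susp (r, x))).2)
    = susp (r, x).
  rewrite /susp (suspensionE actP) ?unit_interval_itv// clampK.
  by rewrite -[RHS]reprK; case: (repr _).
move=> /esym/(suspension_eq actP)[n [/= -> ->]].
by rewrite addrAC /susp (suspensionD actP).
Qed.

Lemma suspension_flowD (e e' : R) (z : L) :
  suspension_flow (e + e') z = suspension_flow e' (suspension_flow e z).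
Proof.
have [[r x] _ ->] := suspension_surj actP z.
by rewrite (suspension_flowE e r x) !suspension_flowE addrA.
Qed.

Lemma suspension_flow0 (z : L) : suspension_flow 0 z = z.
Proof.
by have [[r x] _ ->] := suspension_surj actP z; rewrite suspension_flowE addr0.
Qed.

Lemma mapping_torus_proj_flow (e : R) (z : L) :
  mapping_torus_proj (suspension_flow e z) = rotate e (mapping_torus_proj z).
Proof.
have [[r x] _ ->] := suspension_surj actP z.
by rewrite suspension_flowE !mapping_torus_proj_suspension rotate_expo.
Qed.

(** Upstairs the flow is (e, (r, x)) |-> (r + e, x), and neighbourhoods in L
    are images of neighbourhoods upstairs. *)
Lemma suspension_flow_continuous :
  continuous (fun u : R * L => suspension_flow u.1 u.2).
Proof.
move=> [e z] O nO; have [[r x] _ ze] := suspension_surj actP z.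
have : \forall v \near (e, (r, x)), O (susp (v.2.1 + v.1, v.2.2)).
  have : {for (e, (r, x)), continuous
      (fun v : R * (R * F) => susp (v.2.1 + v.1, v.2.2))}.
    apply: (@continuous_comp _ _ _ (fun v : R * (R * F) => (v.2.1 + v.1, v.2.2)));
      last exact: (suspension_continuous actP).
    have C2 : {for (e, (r, x)), continuous (snd : R * (R * F) -> R * F)} by exact: cvg_snd.
    apply: (@continuous_pair _ R F (fun v : R * (R * F) => v.2.1 + v.1)
      (fun v => v.2.2)).
      apply: (@cvgD _ R^o); last exact: cvg_fst.
      by apply: (@continuous_comp _ _ _ snd fst) => //; exact: cvg_fst.
    by apply: (@continuous_comp _ _ _ snd snd) => //; exact: cvg_snd.
  by apply; move: nO; rewrite /= ze suspension_flowE.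
move=> [[B C] /= [nB nC] BCO]; exists (B, susp @` C) => /=.
  split=> //; rewrite ze; apply/(nbhs_suspension actP).
  by apply: filterS nC => t Bt; exists t.
move=> [e' _] [/= Be' [[r' x'] Cu <-]].
by rewrite suspension_flowE; exact: (BCO (e', (r', x'))).
Qed.

End Flow.

(** * The fibres of a mapping torus *)

Section Fibres.
Variables (R : realType) (F : topologicalType) (f : F -> F).
Variable act : int -> F -> F.
Hypothesis actP : int_action f act.

Local Notation L := (@mapping_torus R F f).
Local Notation susp := (suspension f act).
Local Notation p := (@mapping_torus_proj R F f).

Lemma fibre_suspension (r : R) (z : L) : p z = expo r -> exists x, z = susp (r, x).
Proof.
have [[r' x] _ ->] := suspension_surj actP z.
rewrite mapping_torus_proj_suspension => /expo_eq[n ->].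
by exists (act n x); rewrite (suspensionD actP).
Qed.

Lemma fibre_inj (r : R) (x y : F) : susp (r, x) = susp (r, y) -> x = y.
Proof.
move=> /(suspension_eq actP)[n [/= rn ->]].
have -> : n = 0; last by case: actP => ->.
by apply/eqP; rewrite -(intr_eq0 R); apply/eqP/(addrI r); rewrite -rn addr0.
Qed.

Lemma fibre_continuous (r : R) : continuous (fun x : F => susp (r, x)).
Proof.
move=> x A /(suspension_continuous actP) nA.
exact: (@continuous_pairr R F r x _ nA).
Qed.

Lemma fibre_compact (c : circle R) :
  compact [set: F] -> compact (p @^-1` [set c]).
Proof.
have [r ->] := expo_surj c => cF.
suff -> : p @^-1` [set expo r] = (fun x => susp (r, x)) @` [set: F].
  apply: continuous_compact => //; apply: continuous_subspaceT.
  exact: fibre_continuous.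
apply/seteqP; split=> [z /= /fibre_suspension[x ->]|_ [x _ <-]]; first by exists x.
by rewrite /= mapping_torus_proj_suspension.
Qed.

(** The map g inverts x |-> suspension (r, x) on A. It is continuous: for C
    open in F, the image of ]r - 1/2, r + 1/2[ x C is open in L and, since no
    nonzero integer has absolute value below 1/2, it meets the fibre in
    exactly the image of C. So g maps A onto a connected subset of F, which is
    a point. *)
Lemma connected_fibre_eq (c : circle R) (A : set L) :
  totally_disconnected [set: F] -> connected A -> A `<=` p @^-1` [set c] ->
  forall z z', A z -> A z' -> z = z'.
Proof.
have [r ->] := expo_surj c => tdF cA Ap z z' Az Az'.
have [x0 _] := fibre_suspension (Ap z Az).
have [g gE] : exists g : L -> F, forall w, A w -> w = susp (r, g w).
  have : forall w, exists x, A w -> w = susp (r, x).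
    move=> w; have [/Ap/fibre_suspension[x ->]|nA] := pselect (A w).
      by exists x.
    by exists x0.
  by move=> /choice[g gE]; exists g.
have gC : {within A, continuous g}.
  apply/subspace_continuousP => w Aw C nC.
  have : nbhs (susp (r, g w)) (susp @` ([set t | `|r - t| < 2^-1] `*` C)).
    apply/(nbhs_suspension actP).
    exists ([set t | `|r - t| < 2^-1], C) => /=; last first.
      by move=> [t x] [/= rt Cx]; exists (t, x).
    by split=> //; apply/(@nbhs_ballP _ R^o); exists 2^-1; rewrite //= invr_gt0.
  rewrite -gE//; apply: (@filterS _ (nbhs w)) => w' [[t x] [/= rt Cx] e] Aw'.
  have : susp (t, x) = susp (r, g w') by rewrite e -gE.
  move=> /(suspension_eq actP)[n [/= e1 e2]].
  have n0 : n = 0.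
    move: rt; rewrite e1 [t + _]addrC addrK; apply: contraTeq => n0.
    rewrite -leNgt -intr_norm; apply: (@le_trans _ _ 1%:~R); first by lra.
    by rewrite ler_int -gtz0_ge1 normr_gt0.
  have gw : g w' = x by rewrite e2 n0; case: actP => ->.
  by rewrite -gw in Cx.
have /(congr1 (fun B => B (g z'))) := tdF (g z) I.
have cgA : connected_component [set: F] (g z) (g z').
  exists (g @` A); last by exists z'.
  by split=> //; exact: connected_continuous_connected.
move=> e; have gzz' : [set g z] (g z') by rewrite -e.
by rewrite (gE _ Az) (gE _ Az') gzz'.
Qed.

Lemma fibre_totally_disconnected (c : circle R) :
  totally_disconnected [set: F] -> totally_disconnected (p @^-1` [set c]).
Proof.
move=> tdF z pz; apply/seteqP; split=> [z' cz'|_ ->]; last exact: connected_component_refl.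
apply/esym/(connected_fibre_eq (A := connected_component (p @^-1` [set c]) z)) => //.
- exact: component_connected.
- exact: connected_component_sub.
- exact: connected_component_refl.
Qed.

End Fibres.

(** * The space of paths *)

Section Paths.
Variables (R : realType) (Y : topologicalType).
Local Notation I := (unit_interval R).

Lemma unit_interval_imageE : [set: I] = @clamp R @` `[0, 1].
Proof.
apply/seteqP; split=> // s _; exists (\val s); last exact: clampK.
by rewrite /= in_itv /= unit_interval_itv.
Qed.

Lemma unit_interval_compact : compact [set: I].
Proof.
rewrite unit_interval_imageE; apply: continuous_compact; last exact: segment_compact.
by apply: continuous_subspaceT; exact: clamp_continuous.
Qed.

Lemma unit_interval_connected : connected [set: I].
Proof.
rewrite unit_interval_imageE; apply: connected_continuous_connected.
  exact: segment_connected.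
by apply: continuous_subspaceT; exact: clamp_continuous.
Qed.

Lemma nbhs_unit_interval (t : I) (A : set I) : nbhs t A ->
  exists2 e : R, 0 < e & forall s : I, `|\val t - \val s| < e -> A s.
Proof.
move=> [_ [[W oW <-] /= Wt] WA].
have /(@nbhs_ballP _ R^o)[e /= e0 eW] : nbhs (\val t : R) W by exact: open_nbhs_nbhs.
by exists e => // s ts; apply: WA; exact: eW.
Qed.

Lemma near_unit_interval (t : I) (e : R) : 0 < e ->
  \forall s \near t, `|\val t - \val s| < e.
Proof.
move=> e0; apply: (@unit_interval_val_continuous R t [set r | `|\val t - r| < e]).
by apply/(@nbhs_ballP _ R^o); exists e.
Qed.

(** The subbasic open sets of the compact-open topology, seen on paths. *)
Lemma path_space_open (K : set I) (O : set Y) : compact K -> open O ->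
  open [set a : path_space R Y | (a : I -> Y) @` K `<=` O].
Proof.
move=> cK oO; exists ([set g | g @` K `<=` O] : set {compact-open, I -> Y}) => //.
exact: compact_open_open.
Qed.

(** Evaluation is continuous because the interval is locally compact: a small
    closed interval K around t is mapped into O by a, and mapping K into O is
    an open condition on paths. *)
Lemma path_eval_continuous : continuous (fun u : path_space R Y * I => u.1 u.2).
Proof.
move=> [a t] A; rewrite nbhsE => -[O [oO Oat] OA].
have /nbhs_unit_interval[e e0 eO] : nbhs t ((a : I -> Y) @^-1` O).
  by apply: (@cts_fun _ _ a t); exact: open_nbhs_nbhs.
pose K : set I := @clamp R @` `[\val t - e / 2, \val t + e / 2].
have cK : compact K.
  apply: continuous_compact; last exact: segment_compact.
  by apply: continuous_subspaceT; exact: clamp_continuous.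
exists ([set b : path_space R Y | (b : I -> Y) @` K `<=` O],
        [set s : I | `|\val t - \val s| < e / 2]) => /=.
  split; last by apply: near_unit_interval; rewrite divr_gt0.
  apply: open_nbhs_nbhs; split; first exact: path_space_open.
  move=> _ [s [r /= rt <-] <-]; apply: eO.
  have := unit_interval_itv t; move: rt; rewrite in_itv /=.
  move=> /andP[tr rt] /andP[t0 t1]; rewrite ltr_norml /=.
  by case: (leP r 1) => r1; case: (leP 0 _) => r0; apply/andP; split; lra.
move=> [b s] /= [bK st]; apply: OA; apply: bK; exists s => //.
exists (\val s); last exact: clampK.
by rewrite /= in_itv /=; move: st; rewrite ltr_norml; lra.
Qed.

(** If g x maps the compact set K into O, joint continuity gives for each t in
    K a neighbourhood of (x, t), and compactness of K makes the neighbourhood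
    of x uniform. *)
Lemma path_curry_continuous (T : topologicalType) (g : T -> path_space R Y) (x : T) :
  (forall t, {for (x, t), continuous (fun u : T * I => g u.1 u.2)}) ->
  {for x, continuous g}.
Proof.
move=> gC A [_ [[W oW <-] Wg] WA].
have gx : {compact-open, (fun y => g y : I -> Y) @ x --> (g x : I -> Y)}.
  apply/compact_open_cvgP => K O cK oO gKO.
  have /(_ _ (nbhs x) (fun y t => O (g y t))) := (compact_near_coveringP K).1 cK.
  have ev t : K t -> \forall t' \near t & y \near x, O (g y t').
    move=> Kt; have : nbhs (g x t) O.
      by apply: open_nbhs_nbhs; split=> //; apply: gKO; exists t.
    by move=> /(gC t)[[B C] [nB nC] BC]; exists (C, B) => // -[t' y] [Ct By]; exact: (BC (y, t')).
  move=> /(_ _ ev); apply: filterS => y yK _ [t Kt <-]; exact: yK.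
apply: (@filterS _ (nbhs x) _ _ _ (fun y => WA (g y))).
by apply: gx; exact: open_nbhs_nbhs.
Qed.

End Paths.

(** * Lifting paths along the flow *)

Section LiftAngle.
Variable R : realType.
Local Notation I := (unit_interval R).
Local Notation "0I" := (unit_interval0 R).

(** Pieces of length at most 1 / (n + 1) are short enough for the angle between
    the images of two of their points to be continuous. *)
Definition fine_mesh (n : nat) (a : I -> circle R) :=
  forall s t : I, `|\val s - \val t| <= n.+1%:R^-1 ->
  `|angle (a s) (a t)| < 2^-1.

Definition scale (r : R) (t : I) : I := clamp (\val t * r).

(** The pieces are [t i / (n + 1), t (i + 1) / (n + 1)], of length proportional
    to t, so that their number does not depend on t. *)
Definition lift_angle (n : nat) (a : I -> circle R) (t : I) : R :=
  \sum_(i < n.+1) angle (a (scale (i%:R / n.+1%:R) t))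
                        (a (scale (i.+1%:R / n.+1%:R) t)).

Lemma angle0 (c : circle R) : angle c c = 0.
Proof.
by have [r ->] := expo_surj c; rewrite angle_expo subrr centered_id; lra.
Qed.

Lemma scale_val (r : R) (t : I) : 0 <= r <= 1 -> \val (scale r t) = \val t * r.
Proof.
move=> /andP[r0 r1]; have /andP[t0 t1] := unit_interval_itv t.
by rewrite clampE// mulr_ge0// mulr_ile1.
Qed.

Lemma scale0 (t : I) : scale 0 t = 0I.
Proof. by apply: val_inj; rewrite scale_val ?lexx ?ler01// mulr0. Qed.

Lemma scale1 (t : I) : scale 1 t = t.
Proof. by rewrite /scale mulr1 clampK. Qed.

Lemma scale_continuous (r : R) : continuous (scale r).
Proof.
have mulC : continuous (fun t : R => t * r).
  by move=> t; apply: (@cvgMl _ R^o); exact: cvg_id.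
by move=> t A /clamp_continuous/mulC/(@unit_interval_val_continuous R t).
Qed.

Lemma lift_angle_start (n : nat) (a : I -> circle R) : lift_angle n a 0I = 0.
Proof.
have sc r : scale r 0I = 0I.
  by rewrite /scale [\val _]/= mul0r -[RHS]clampK.
by rewrite /lift_angle big1// => i _; rewrite !sc angle0.
Qed.

(** The sum telescopes. *)
Lemma rotate_lift_angle (n : nat) (a : I -> circle R) (t : I) :
  rotate (lift_angle n a t) (a 0I) = a t.
Proof.
suff partial (k : nat) : rotate (\sum_(i < k) angle (a (scale (i%:R / n.+1%:R) t))
    (a (scale (i.+1%:R / n.+1%:R) t))) (a 0I) = a (scale (k%:R / n.+1%:R) t).
  by rewrite partial divff ?pnatr_eq0// scale1.
elim: k => [|k IH]; first by rewrite big_ord0 rotate0 mul0r scale0.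
by rewrite big_ord_recr /= rotateD IH rotate_angle.
Qed.

Variables (T : topologicalType) (a : T -> I -> circle R).
Hypothesis aC : continuous (fun u : T * I => a u.1 u.2).

Lemma lift_angle_continuous (n : nat) (x : T) (t : I) : fine_mesh n (a x) ->
  {for (x, t), continuous (fun u : T * I => lift_angle n (a u.1) u.2)}.
Proof.
move=> fa.
pose term (i : nat) (u : T * I) : R := angle (a u.1 (scale (i%:R / n.+1%:R) u.2))
                        (a u.1 (scale (i.+1%:R / n.+1%:R) u.2)).
have evC r : {for (x, t), continuous (fun u : T * I => a u.1 (scale r u.2))}.
  have scC : {for (x, t), continuous (fun u : T * I => (u.1, scale r u.2))}.
    apply: continuous_pair; first exact: cvg_fst.
    by apply: (@continuous_comp _ _ _ snd (scale r)); [exact: cvg_snd|exact: scale_continuous].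
  by move=> A /(aC (x := (x, scale r t)))/scC.
have termC (i : 'I_n.+1) : {for (x, t), continuous (term i)}.
  have ang : `|angle (a x (scale (i%:R / n.+1%:R) t)) (a x (scale (i.+1%:R / n.+1%:R) t))| < 2^-1.
    have sv (k : nat) : (k <= n.+1)%N ->
        \val (scale (k%:R / n.+1%:R) t) = \val t * (k%:R / n.+1%:R).
      move=> kn; rewrite scale_val// divr_ge0 ?ler0n//=.
      by rewrite ler_pdivrMr ?ltr0n// mul1r ler_nat.
    apply: fa; have /andP[t0 t1] := unit_interval_itv t.
    rewrite !sv//; last exact: ltnW.
    rewrite -mulrBr -mulrBl -[i.+1]addn1 natrD opprD addNKr mulN1r mulrN normrN.
    by rewrite ger0_norm ?mulr_ge0 ?invr_ge0 ?ler0n// ler_piMl// invr_ge0 ler0n.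
  have pairC := @continuous_pair _ _ _ _ _ (x, t) (evC (i%:R / n.+1%:R))
     (evC (i.+1%:R / n.+1%:R)).
  by move=> A /(angle_continuous ang)/pairC.
have sumC (s : seq 'I_n.+1) :
    {for (x, t), continuous (fun u : T * I => \sum_(i <- s) term i u)}.
  elim: s => [|i s IH].
    rewrite (_ : (fun u => _) = cst 0); first exact: cvg_cst.
    by apply/funext => u; rewrite big_nil.
  rewrite (_ : (fun u => _) = (fun u => term i u + \sum_(j <- s) term j u)).
    exact: cvgD (termC i) IH.
  by apply/funext => u; rewrite big_cons.
exact: sumC.
Qed.

(** Uniform continuity, locally uniform in the parameter x. The condition holds
    for s, t near a given time, x near x0 and n large; compactness of the
    interval, for the filter of the pairs (x, n), makes it hold at all times. *)
Lemma fine_near (x0 : T) : exists n, \forall x \near x0, fine_mesh n (a x).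
Proof.
pose P (i : T * nat) (s : I) := forall t : I, `|\val s - \val t| <= i.2.+1%:R^-1 ->
  `|angle (a i.1 s) (a i.1 t)| < 2^-1.
have cov t : [set: I] t -> \forall s \near t & i \near filter_prod (nbhs x0) \oo, P i s.
  move=> _.
  have evC (j : I * I -> I) : {for (t, t), continuous j} -> j (t, t) = t ->
      {for (x0, (t, t)), continuous (fun u : T * (I * I) => a u.1 (j u.2))}.
    move=> jC jt.
    have pC : {for (x0, (t, t)), continuous (fun u : T * (I * I) => (u.1, j u.2))}.
      apply: continuous_pair; first exact: cvg_fst.
      by apply: (@continuous_comp _ _ _ snd j); [exact: cvg_snd|].
    by move=> A /(aC (x := (x0, j (t, t))))/pC.
  have ang : `|angle (a x0 t) (a x0 t)| < 2^-1 by rewrite angle0 normr0 invr_gt0.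
  have nA : nbhs (angle (a x0 t) (a x0 t)) [set r | `|r| < 2^-1].
    by apply: (@norm_continuous _ R^o _ [set t | t < 2^-1]); exact: lt_nbhsl.
  have fstC : {for (t, t), continuous (fst : I * I -> I)} by exact: cvg_fst.
  have sndC : {for (t, t), continuous (snd : I * I -> I)} by exact: cvg_snd.
  have pairC := @continuous_pair _ _ _ _ _ (x0, (t, t))
    (evC fst fstC erefl) (evC snd sndC erefl).
  have [[B C] /= [nB [[C1 C2] /= [nC1 nC2] C12]] BC] := pairC _ (angle_continuous ang nA).
  have [e e0 eC] := nbhs_unit_interval (filterI nC1 nC2).
  have e20 : 0 < e / 2 by rewrite divr_gt0.
  exists ([set s : I | `|\val t - \val s| < e / 2],
          B `*` [set n : nat | n.+1%:R^-1 < e / 2]) => /=.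
    split; first by apply: near_unit_interval; rewrite divr_gt0.
    exists (B, [set n : nat | n.+1%:R^-1 < e / 2]) => //; split=> //=.
    exact: (near_infty_natSinv_lt (PosNum e20)).
  move=> [s [y n]] /= [ts [Ba ne]] s' ss'.
  apply: (BC (y, (s, s'))); split=> //; apply: C12; split => /=.
    by apply: (eC s _).1; rewrite (lt_le_trans ts)// ler_pdivrMr// ler_peMr ?ltW// ltr1n.
  apply: (eC s' _).2; rewrite -(subrKA (\val s)) (le_lt_trans (ler_normD _ _))//.
  by rewrite [ltRHS](splitr e) ltrD// (le_lt_trans ss').
have := (compact_near_coveringP _).1 (@unit_interval_compact R) _ _ P _ cov.
move=> [[B N] /= [nB [n _ nN]] BN]; exists n.
apply: filterS nB => y By s t; apply: (BN (y, n)) => //; split=> //.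
by apply: nN => /=.
Qed.

End LiftAngle.

Section LiftingSuspension.
Variables (R : realType) (F : topologicalType) (f : F -> F).
Variable act : int -> F -> F.
Hypothesis actP : int_action f act.
Hypothesis tdF : totally_disconnected [set: F].

Local Notation I := (unit_interval R).
Local Notation "0I" := (unit_interval0 R).
Local Notation L := (@mapping_torus R F f).
Local Notation p := (@mapping_torus_proj R F f).
Local Notation flow := (@suspension_flow R F f act).

(** Flowing b backwards along the angle turned by its projection gives a path
    in the fibre of b(0); its image is connected, so it is constant. This is
    uniqueness of lifts together with a formula for them. *)
Lemma lift_eq_flow (n : nat) (b : I -> L) (t : I) :
  continuous b -> fine_mesh n (p \o b) ->
  b t = flow (lift_angle n (p \o b) t) (b 0I).
Proof.
move=> bC fb; set e := lift_angle n (p \o b).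
have sndC : continuous (snd : I * I -> I) by move=> u; exact: cvg_snd.
have pbC : continuous (fun u : I * I => p (b u.2)).
  by move=> u A /mapping_torus_proj_continuous/bC/sndC.
have eC : continuous e.
  move=> s A nA.
  have pairC : {for s, continuous (fun s : I => (s, s))}.
    by apply: continuous_pair; exact: cvg_id.
  exact: (pairC _ (@lift_angle_continuous R _ (fun _ : I => p \o b) pbC n s s fb A nA)).
have oppC : continuous (fun r : R => - r).
  by move=> r; apply: cvgN; exact: cvg_id.
have gC : continuous (fun s => flow (- e s) (b s)).
  move=> s A /(suspension_flow_continuous actP (x := (- e s, b s))).
  have pairC : {for s, continuous (fun s => (- e s, b s))}.
    apply: continuous_pair; last exact: bC.
    by move=> B /oppC/eC.
  by move=> /pairC.
have ge : flow (- e t) (b t) = flow (- e 0I) (b 0I).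
  apply: (connected_fibre_eq actP (c := p (b 0I))
    (A := (fun s => flow (- e s) (b s)) @` [set: I])) => //.
  - apply: connected_continuous_connected; first exact: unit_interval_connected.
    exact: continuous_subspaceT.
  - move=> _ [s _ <-] /=; rewrite (mapping_torus_proj_flow actP).
    have := rotate_lift_angle n (p \o b) s; rewrite /= -/e => <-.
    by rewrite -rotateD subrr rotate0.
move: ge; rewrite /e lift_angle_start oppr0 (suspension_flow0 actP) => <-.
by rewrite -(suspension_flowD actP) addNr (suspension_flow0 actP).
Qed.

Lemma flow_lift_continuous (T : topologicalType) (a : T -> I -> circle R)
    (l : T -> L) (n : nat) (x : T) (t : I) :
  continuous (fun u : T * I => a u.1 u.2) -> continuous l -> fine_mesh n (a x) ->
  {for (x, t), continuous (fun u : T * I => flow (lift_angle n (a u.1) u.2) (l u.1))}.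
Proof.
move=> aC lC fx A.
move=> /(suspension_flow_continuous actP (x := (lift_angle n (a x) t, l x))).
have lfC : {for (x, t), continuous (fun u : T * I => l u.1)}.
  by apply: (@continuous_comp _ _ _ fst l); [exact: cvg_fst|exact: lC].
have pairC := continuous_pair (lift_angle_continuous aC (t := t) fx) lfC.
by move=> /pairC.
Qed.

(** The inverse of the map to the pullback sends w = (a, l) to the path
    [lift w]. Its definition uses a mesh N a chosen for the path a, which does not
    vary continuously; but by uniqueness of lifts ([liftE]) any mesh that is
    fine for a gives the same path, and N a is fine for all paths near a. *)
Lemma mapping_torus_lifting_space : lifting_space R p.
Proof.
exists (@mapping_torus_proj_continuous R F f).
set pc := @mapping_torus_proj_continuous R F f.
have evC := @path_eval_continuous R (circle R).
have /choice[N NP] : forall a : path_space R (circle R), exists n,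
    \forall x \near a, fine_mesh n (x : path_space R (circle R)).
  by move=> a; exact: (fine_near evC).
have N1 a : fine_mesh (N a) (a : I -> circle R) by have := nbhs_singleton (NP a).
pose lift (w : path_pullback R p) (t : I) : L :=
  flow (lift_angle (N (\val w).1) ((\val w).1 : I -> circle R) t) (\val w).2.
have wP (w : path_pullback R p) : p (\val w).2 = (\val w).1 0I.
  exact: set_valP w.
have valC : continuous (\val : path_pullback R p -> path_space R (circle R) * L).
  exact: initial_continuous.
have fstC : continuous (fst : path_pullback R p * I -> path_pullback R p).
  by move=> u; exact: cvg_fst.
have val1C : continuous (fun w : path_pullback R p => (\val w).1).
  have pf : continuous (fst : path_space R (circle R) * L -> path_space R (circle R)).
    by move=> u; exact: cvg_fst.
  by move=> w B /(pf (\val w))/valC.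
have val2C : continuous (fun w : path_pullback R p => (\val w).2).
  have ps : continuous (snd : path_space R (circle R) * L -> L).
    by move=> u; exact: cvg_snd.
  by move=> w B /(ps (\val w))/valC.
have evalC : continuous (fun u : path_pullback R p * I => (\val u.1).1 u.2).
  move=> [w t] A /(evC ((\val w).1, t)) [[B C] /= [nB nC] BC].
  exists ((fun w => B (\val w).1), C) => /=; first by split=> //; exact: val1C.
  by move=> [w' t'] [/= Bw Ct]; exact: (BC ((\val w').1, t')).
have projl w t : p (lift w t) = (\val w).1 t.
  by rewrite /lift (mapping_torus_proj_flow actP) wP rotate_lift_angle.
have lift0 w : lift w 0I = (\val w).2.
  by rewrite /lift lift_angle_start (suspension_flow0 actP).
have formC n (w : path_pullback R p) (t : I) : fine_mesh n ((\val w).1 : I -> circle R) ->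
    {for (w, t), continuous (fun u : path_pullback R p * I =>
       flow (lift_angle n ((\val u.1).1 : I -> circle R) u.2) (\val u.1).2)}.
  exact: (@flow_lift_continuous _ (fun w : path_pullback R p => (\val w).1 : I -> circle R)
    (fun w => (\val w).2) n w t evalC val2C).
have liftC w : continuous (lift w).
  move=> t A nA.
  have pairC := @continuous_pairr (path_pullback R p) I w t.
  exact: (pairC _ (formC (N (\val w).1) w t (N1 _) A nA)).
have liftE n (w : path_pullback R p) (t : I) : fine_mesh n ((\val w).1 : I -> circle R) ->
    lift w t = flow (lift_angle n ((\val w).1 : I -> circle R) t) (\val w).2.
  move=> fw; have pl : p \o lift w = (\val w).1 :> (I -> circle R).
    by apply/funext => s; rewrite /= projl.
  by rewrite (@lift_eq_flow n) ?pl ?lift0.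
split.
  apply: (@continuous_comp_initial _ _ _ set_val) => b.
  apply: continuous_pair.
    apply: path_curry_continuous => t A nA.
    exact: (path_eval_continuous (pc _ _ nA)).
  move=> A /(@path_eval_continuous R L (b, 0I)) [[B C] /= [nB nC] BC].
  apply: filterS nB => b' Bb; apply: (BC (b', 0I)); split=> //.
  exact: (nbhs_singleton nC).
exists (fun w => mkcts (liftC w) : path_space R L); split.
- move=> w; apply: path_curry_continuous => t A nA.
  have fw := fstC (w, t) _ (val1C w _ (NP (\val w).1)).
  have := formC (N (\val w).1) w t (N1 _) A.
  rewrite /= -liftE//; move=> /(_ nA).
  by apply: (@filterS2 _ (nbhs (w, t)) _ _ _ _ _ fw) => u fu; rewrite /= -liftE.
- move=> b; apply/continuousEP => t /=.
  by rewrite /mkcts [RHS](@lift_eq_flow (N (path_push pc b))) //; exact: cts_fun.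
- move=> w; apply: val_inj => /=.
  apply: injective_projections; last exact: lift0.
  by apply/continuousEP => t /=; exact: projl.
Qed.

End LiftingSuspension.

(** * Inverse limits of finite coverings *)

Section Coverings.
Variables (E B : topologicalType) (q : E -> B).

Lemma homeo_onto_inj (V : set E) (U : set B) (e e' : E) :
  homeo_onto q V U -> V e -> V e' -> q e = q e' -> e = e'.
Proof.
move=> [h [[_ [k [_ hK _]]] hE]] Ve Ve' qe.
have : h (SigSub (mem_set Ve)) = h (SigSub (mem_set Ve')).
  by apply: val_inj; rewrite !hE.
by move=> /(can_inj hK)/(congr1 val).
Qed.

(** The two points lie in sheets over the same evenly covered set: in the same
    one if e = e', in disjoint ones otherwise. *)
Lemma covering_separation (e e' : E) : covering_space q -> q e = q e' ->
  exists V V' : set E, [/\ nbhs e V, nbhs e' V' &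
    forall a a', V a -> V' a' -> q a = q a' -> (a = a' <-> e = e')].
Proof.
move=> [_ /(_ (q e))[U [_ Ue [S [tS cS SP]]]]] qe.
have sheet a : U (q a) -> exists2 V, S V & V a.
  by move=> Ua; have : (q @^-1` U) a by []; rewrite -cS => -[V SV Va]; exists V.
have [V SV Ve] := sheet e Ue.
have [V' SV' Ve'] : exists2 V, S V & V e' by apply: sheet; rewrite -qe.
have [[oV hV] [oV' hV']] := (SP _ SV, SP _ SV').
exists V, V'; split; [exact: open_nbhs_nbhs|exact: open_nbhs_nbhs|].
move=> a a' Va Va' qa; split=> [aa'|ee'].
  rewrite -aa' in Va'.
  have VV' : V = V' by apply: tS => //; exists a.
  by rewrite -VV' in Ve'; exact: (homeo_onto_inj hV).
rewrite -ee' in Ve'.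
have VV' : V = V' by apply: tS => //; exists e.
by rewrite -VV' in Va'; exact: (homeo_onto_inj hV).
Qed.

(** Two lifts of the same map agree on an open and closed set. *)
Lemma covering_near_eq (T : topologicalType) (g h : T -> E) (t : T) :
  covering_space q -> {for t, continuous g} -> {for t, continuous h} ->
  (forall s, q (g s) = q (h s)) ->
  \forall s \near t, g s = h s <-> g t = h t.
Proof.
move=> cq gt ht gh.
have [V [V' [/gt nV /ht nV' VV']]] := covering_separation cq (gh t).
by apply: (@filterS2 _ (nbhs t) _ _ _ _ _ nV nV') => s Vs Vs'; exact: VV'.
Qed.

Lemma covering_unique_lift (T : topologicalType) (g h : T -> E) (t0 : T) :
  connected [set: T] -> covering_space q -> continuous g -> continuous h ->
  (forall s, q (g s) = q (h s)) -> g t0 = h t0 -> g = h.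
Proof.
move=> cT cq gC hC gh gh0; apply/funext => t.
have near_eq s := covering_near_eq cq (gC s) (hC s) gh.
suff : [set s | g s = h s] = [set: T] by move=> e; have : [set: T] t by []; rewrite -e.
apply: cT; first by exists t0.
- exists [set s | g s = h s]; last by rewrite setTI.
  rewrite openE => s /= ghs; rewrite /interior.
  by apply: filterS (near_eq s) => s' [_ /(_ ghs)].
- exists [set s | g s = h s]; last by rewrite setTI.
  rewrite -openC openE => s /= ghs; rewrite /interior.
  by apply: filterS (near_eq s) => s' [e _] /e/ghs.
Qed.

End Coverings.

Section InverseLimit.
Variables (R : realType) (F : topologicalType) (f : F -> F).
Variable act : int -> F -> F.
Hypothesis actP : int_action f act.
Hypothesis cF : compact [set: F].

Local Notation L := (@mapping_torus R F f).
Local Notation p := (@mapping_torus_proj R F f).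
Local Notation susp := (suspension f act).

(** The second hypothesis says that A is clopen. Compactness makes A a union of
    level sets of one map c n to a finite set; two points act i x and act j x have
    the same image under it, and so have all their common translates, so j - i is
    a period. *)
Lemma inverse_limit_periodic (A : set F) (x : F) :
  inverse_limit_of_finite_coverings p ->
  (forall y, \forall z \near y, A z <-> A y) ->
  exists2 N : nat, (0 < N)%N & forall k : nat, A (act (k + N)%N x) <-> A (act k x).
Proof.
move=> [E [q [b [fq bC qb [h [[hC [h' [_ hK _]]] hp]]]]]] lcA.
(* c n y is the image in E n of the point y of the fibre of L over expo 0 *)
pose c n y : E n := \val (h (susp (0, y))) n.
have pC n : continuous (fun z => \val (h z) n : E n).
  have valC : continuous (\val : inverse_limit b -> prod_topology E).
    exact: initial_continuous.
  have prC : continuous (fun u : prod_topology E => u n) by exact: proj_continuous.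
  by move=> z V /(prC (\val (h z)))/valC/hC.
have bh n z : b n (\val (h z) n.+1) = \val (h z) n.
  exact: (set_valP (h z)).
have qh n z : q n (\val (h z) n) = p z.
  by elim: n => [|n IH]; [exact: hp|rewrite -qb bh].
have qc n y : q n (c n y) = expo 0 by rewrite qh mapping_torus_proj_suspension.
have cC n : continuous (c n).
  by move=> y V /pC; exact: (fibre_continuous actP).
have c_act n y z (k : int) : c n y = c n z -> c n (act k y) = c n (act k z).
  (* t |-> suspension (t, w) runs through the points act k w of the fibre over
     expo 0, at the integer times t = - k; two such paths have images in E n that
     lift the same path of the circle, so they agree if they do so at t = 0 *)
  pose g w (t : R) : E n := \val (h (susp (t, w))) n.
  have gC w : continuous (g w).
    move=> t V /pC /(suspension_continuous actP) nV.
    have pairC : {for t, continuous (fun t : R => (t, w))}.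
      by apply: continuous_pair; [exact: cvg_id|exact: cvg_cst].
    exact: (pairC _ nV).
  have gE w : c n (act k w) = g w (- k%:~R).
    by rewrite /c /g -(suspensionD actP k (- k%:~R)) addNr.
  rewrite !gE => yz; congr (_ _).
  apply: (covering_unique_lift (t0 := 0) _ (fq n).1 (gC y) (gC z)) => //.
    exact/connected_intervalP.
  by move=> t; rewrite !qh !mapping_torus_proj_suspension.
have c_le m n y z : (m <= n)%N -> c n y = c n z -> c m y = c m z.
  move=> /subnK <-; elim: (n - m)%N => // d IH e; apply: IH.
  by rewrite /c -[LHS]bh -[RHS]bh; congr (b _ _).
have c_sep y z : (forall n, c n y = c n z) -> y = z.
  move=> e; apply: (fibre_inj actP (r := 0)); apply: (can_inj hK); apply: val_inj.
  exact: functional_extensionality_dep.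
have [n nA] : exists n, forall y z, c n y = c n z -> (A y <-> A z).
  (* compactness of F x F: near a pair of points with the same image in every
     E m, that is a pair (z, z), membership in A is constant; near any other
     pair the images in E n differ for all large n *)
  pose P (n : nat) (u : F * F) := c n u.1 = c n u.2 -> (A u.1 <-> A u.2).
  have cFF : compact [set: F * F] by rewrite -setXTT; exact: compact_setX.
  have cov u : [set: F * F] u -> \forall v \near u & n \near \oo, P n v.
    move=> _; case: u => y z.
    have [yz|/existsNP[m cyz]] := pselect (forall n, c n y = c n z).
      have := lcA z; rewrite (c_sep _ _ yz) => lcz.
      exists ([set w | A w <-> A z] `*` [set w | A w <-> A z], setT).
        by split; [exists ([set w | A w <-> A z], [set w | A w <-> A z])|exact: filterT].
      by move=> [[y' z'] n] [/= [y'z z'z] _] _; rewrite y'z z'z.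
    have fC : {for (y, z), continuous (fun u : F * F => c m u.1)}.
      by apply: (@continuous_comp _ _ _ fst (c m)); [exact: cvg_fst|exact: cC].
    have sC : {for (y, z), continuous (fun u : F * F => c m u.2)}.
      by apply: (@continuous_comp _ _ _ snd (c m)); [exact: cvg_snd|exact: cC].
    have nV := covering_near_eq (fq m).1 fC sC (fun u => etrans (qc m u.1) (esym (qc m u.2))).
    exists ([set u | c m u.1 = c m u.2 <-> c m y = c m z], [set n | (m <= n)%N]).
      by split=> //; exists m.
    by move=> [u n] [/= ue mn] /(c_le _ _ _ _ mn)/ue.
  have [N _ NP] := (compact_near_coveringP _).1 cFF _ _ P _ cov.
  by exists N => y z; exact: (NP N (leqnn N) (y, z) I).
have [i [j [ij cij]]] : exists i j : nat, (i < j)%N /\ c n (act i x) = c n (act j x).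
  pose g (k : nat) := c n (act k x).
  apply: contrapT => noij; apply: infinite_nat.
  have -> : [set: nat] = g @^-1` (q n @^-1` [set expo 0]).
    by apply/seteqP; split=> // k _; exact: qc.
  apply: finite_preimage; last exact: (fq n).2.
  move=> i j _ _ gij; apply/eqP; rewrite eqn_leq; apply/andP; split;
    rewrite leqNgt; apply/negP => lt; apply: noij.
    by exists j, i; split=> //; exact/esym.
  by exists i, j.
exists (j - i)%N; first by rewrite subn_gt0.
move=> k; apply/nA.
have actE (m : nat) : act (k%:Z - i%:Z) (act m x) = act (k%:Z - i%:Z + m%:Z) x.
  by case: actP.
have := c_act n _ _ (k%:Z - i%:Z) cij; rewrite !actE subrK => ->.
by congr (c n (act _ x)); rewrite PoszD -subzn ?(ltnW ij)// addrA addrAC.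
Qed.

End InverseLimit.

(** * The Morse-Thue system *)

Lemma morse_space_compact : compact [set: morse_space].
Proof.
apply: set_type_compact; apply: (subclosed_compact (B := [set: biseq])) => //.
  exact: closed_closure.
have := @tychonoff int (fun=> bool) (fun=> setT) (fun=> bool_compact).
by congr (compact _); apply/seteqP; split.
Qed.

Lemma morse_space_coord (k : int) (x : morse_space) :
  \forall y \near x, \val y k = \val x k.
Proof.
have valC : continuous (\val : morse_space -> biseq) by exact: initial_continuous.
have prC : continuous (fun y : biseq => y k).
  exact: (@proj_continuous int (fun=> bool) k).
have nb : nbhs (\val x k) [set \val x k].
  by apply/principal_filterP.
exact: (valC _ _ (prC _ _ nb)).
Qed.

Lemma morse_space_totally_disconnected : totally_disconnected [set: morse_space].
Proof.
apply: zero_dimension_totally_disconnected => x y xy.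
have [k xyk] : exists k, \val x k != \val y k.
  apply: contrapT => /forallNP eq; move/eqP: xy; apply; apply: val_inj; apply/funext => k.
  by apply/eqP/negPn/negP; exact: eq.
exists [set z | \val z k = \val x k]; split=> //; last by apply/eqP; rewrite eq_sym.
split.
  by rewrite openE => z /= zk; rewrite /interior; apply: filterS (morse_space_coord k z) => w /= ->.
rewrite -openC openE => z /= zk; rewrite /interior.
by apply: filterS (morse_space_coord k z) => w /= ->.
Qed.

Lemma shift_pow_continuous (k : int) : continuous (shift_pow k).
Proof.
rewrite (_ : shift_pow k = fun x n => x (n + k)); last by apply/funext => x; rewrite shift_powE.
exact: (biseq_reindex_continuous (s := fun n => n + k)).
Qed.

Lemma morse_set_shift_pow (k : int) (x : morse_space) : shift_pow k (\val x) \in morse_set.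
Proof.
apply/mem_set; apply: (@morse_set_invariant _ k (@shift_pow_continuous k)) => //.
exact: set_valP.
Qed.

Definition morse_action (k : int) (x : morse_space) : morse_space :=
  exist _ (shift_pow k (\val x)) (morse_set_shift_pow k x).

Lemma morse_actionP : int_action morse_shift morse_action.
Proof.
split.
- by move=> x; apply: val_inj.
- move=> m n x; apply: val_inj; rewrite /= !shift_powE; apply/funext => k.
  by rewrite addrA.
- by move=> x; apply: val_inj.
- move=> k; apply: (@continuous_comp_initial _ _ _ set_val) => x A.
  move=> /(@shift_pow_continuous k (\val x)).
  exact: (@initial_continuous morse_space biseq \val x).
Qed.

(** Induction along the prefixes of length 2^k: the second half of each prefix
    is the negation of the first half, at position n as at positions 2n and
    2n + 1. *)
Lemma morse_thue_double (n : nat) :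
  morse_thue n.*2 = morse_thue n /\ morse_thue n.*2.+1 = ~~ morse_thue n.
Proof.
have flip (k m : nat) : (m < 2 ^ k)%N -> morse_thue (2 ^ k + m)%N = ~~ morse_thue m.
  move=> mk; rewrite -(@nth_morse_thue_word k.+1); last by rewrite expnS mul2n -addnn ltn_add2l.
  rewrite /= nth_cat size_morse_thue_word ltnNge leq_addr /= addKn.
  by rewrite (nth_map false) ?size_morse_thue_word// nth_morse_thue_word.
suff : forall k m, (m < 2 ^ k)%N ->
    morse_thue m.*2 = morse_thue m /\ morse_thue m.*2.+1 = ~~ morse_thue m.
  by apply; exact: (ltn_expl n (isT : (1 < 2)%N)).
elim=> [|k IH] m; first by case: m.
have [/IH //|km] := ltnP m (2 ^ k)%N.
rewrite -(subnKC km) expnS mul2n -addnn ltn_add2l => /[dup] mk /IH[e1 e2].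
have k2 : (2 ^ k)%N.*2 = (2 ^ k.+1)%N by rewrite expnS mul2n.
rewrite doubleD k2 -addnS !flip// ?e1 ?e2//.
- by rewrite -k2 ltn_Sdouble.
- by rewrite -k2 ltn_double.
Qed.

(** Halving rules out an even period; for a period 2j + 1, comparing the terms of
    indices 2n and 2n + 2j + 1 gives t(n + j) = 1 - t(n), absurd for n = j since
    t(2j) = t(j). *)
Lemma morse_thue_aperiodic (N : nat) : (0 < N)%N ->
  ~ forall n, morse_thue (n + N)%N = morse_thue n.
Proof.
have [N2] := ubnP N; elim: N2 N => // N2 IH N NN2 N0 per.
have := odd_double_half N; move: (N./2) => j; case: (odd N) => /= NE; last first.
  rewrite add0n in NE; rewrite -NE double_gt0 in N0 NN2.
  apply: (IH j) => // [|n].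
    by rewrite -ltnS (leq_trans _ NN2)// ltnS -addnn -[X in (X < _)%N]addn0 ltn_add2l.
  have := per n.*2; rewrite -NE -doubleD.
  by rewrite !(morse_thue_double _).1.
rewrite add1n in NE.
have p0 n : morse_thue (n + j)%N = ~~ morse_thue n.
  have := per n.*2; rewrite -NE addnS -doubleD (morse_thue_double _).1 (morse_thue_double _).2.
  by move=> <-; rewrite negbK.
have := (morse_thue_double j).1; rewrite -addnn p0; by case: (morse_thue j).
Qed.

(** * The mapping torus of the Morse-Thue system *)

Theorem theorem3p2 (R : realType) :
  let p := @mapping_torus_proj R morse_space morse_shift in
  [/\ lifting_space R p,
      forall x : circle R,
        compact (p @^-1` [set x]) /\ totally_disconnected (p @^-1` [set x]) &
      ~ inverse_limit_of_finite_coverings p].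
Proof.
move=> p; split.
- exact: (mapping_torus_lifting_space R morse_actionP morse_space_totally_disconnected).
- move=> x; split.
    exact: (fibre_compact morse_actionP morse_space_compact).
  exact: (fibre_totally_disconnected morse_actionP morse_space_totally_disconnected).
have omega0P : omega0 \in morse_set.
  by apply/mem_set/subset_closure; exists 0.
pose w : morse_space := exist _ omega0 omega0P.
move=> plim.
pose A := [set x : morse_space | \val x 0].
have lcA (y : morse_space) : \forall z \near y, A z <-> A y.
  by apply: filterS (morse_space_coord 0 y) => z; rewrite /A /= => ->.
have [N N0 per] := inverse_limit_periodic morse_actionP morse_space_compact w plim lcA.
apply: (morse_thue_aperiodic N0) => k.
have actE (m : nat) : \val (morse_action m w) 0 = morse_thue m.
  by rewrite [LHS](_ : _ = shift_pow m omega0 0)// shift_powE add0r.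
have perk : morse_thue (k + N)%N <-> morse_thue k by rewrite -!actE; exact: per.
by apply/idP/idP; case: perk.
Qed.
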